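(* For every $1\le\delta<2$ we have $\alpha_{\star}(\delta,3)\ge 1+\frac{\delta}{2}$.
   Context: All logarithms are in base $2$. $G_{n,\frac12}$ denotes the random graph on vertex set $V=\{1,\dots,n\}$ in which each of the $\binom n2$ pairs of vertices is an edge independently with probability $\frac12$. Probe model with $\ell$ rounds. An algorithm has unbounded computation time and accesses the input graph $G$ only by probes; a probe of a pair $(i,j)$, $1\le i<j\le n$, reveals whether $(i,j)$ is an edge of $G$. The algorithm proceeds in $\ell$ rounds: in round $1$ it selects a set $E_1$ of pairs and the status (edge or non-edge) of all pairs in $E_1$ is revealed; for $2 \le i\le \ell$, in round $i$ it selects a set $E_i$ of pairs, depending on the outcomes of the probes in rounds $1,\dots,i-1$, and the status of all pairs in $E_i$ is revealed. All probes of one round are done in parallel. After round $\ell$ the algorithm outputs a set of vertices, which it has to ensure is a clique of $G$. The total number of probes is $\sum_{i=1}^{\ell}|E_i|$. $\alpha_{\star}(\delta,\ell)$ is the supremum over all $\alpha$ such that there exists an algorithm (one for each $n$) that, on a graph drawn at random from $G_{n,\frac12}$, probes at most $n^{\delta}$ entries of the adjacency matrix, with the probes being done in $\ell$ rounds, and outputs a clique of size at least $\alpha\log n$ with probability at least $\frac12$, for all sufficiently large $n$. *)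

(* Defs.v *)
From mathcomp Require Import all_boot all_order all_algebra.
From mathcomp Require Import all_classical all_reals all_analysis.

Set Implicit Arguments.
Unset Strict Implicit.
Unset Printing Implicit Defensive.

Import Order.TTheory GRing.Theory Num.Theory.
Local Open Scope classical_set_scope.
Local Open Scope ring_scope.

(* Vertices are 'I_n, i.e. {0, ..., n-1}; a pair (i, j) always has i < j. *)
Notation vpair n := {e : 'I_n * 'I_n | (e.1 < e.2)%N}.

(* A simple graph is its set of edges. *)
Notation graph n := {set vpair n}.

Definition is_clique n (G : graph n) (S : {set 'I_n}) : Prop :=
  forall e : vpair n, (val e).1 \in S -> (val e).2 \in S -> e \in G.

Definition Gnp_pr (R : realType) (n : nat) (p : R) (ev : pred (graph n)) : R :=
  \sum_(G : graph n | ev G) \prod_(e : vpair n) (if e \in G then p else 1 - p).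

(* One entry per completed round, oldest first: the set of pairs probed in the
   round, and the subset of those that turned out to be edges. *)
Definition history (n : nat) : Type := seq ({set vpair n} * {set vpair n}).

(* The current round number is available to [query] as the size of the
   history. *)
Record algorithm (n : nat) := Algorithm {
  query : history n -> {set vpair n};
  result : history n -> {set 'I_n} }.

Fixpoint run n (A : algorithm n) (l : nat) (G : graph n) : history n :=
  if l is l'.+1 then
    let h := run A l' G in
    rcons h (query A h, query A h :&: G)%SET
  else [::].

Definition num_probes n (A : algorithm n) (l : nat) (G : graph n) : nat :=
  \sum_(r <- run A l G) #|r.1|.

Definition output n (A : algorithm n) (l : nat) (G : graph n) : {set 'I_n} :=
  result A (run A l G).

Definition log2 (R : realType) (x : R) : R := ln x / ln 2.

(* The probe budget and the guarantee that the output is a clique are required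
   on every input graph; only the size of the clique is probabilistic. *)
Definition achievable (R : realType) (delta : R) (l : nat) (alpha : R) : Prop :=
  exists A : forall n, algorithm n, \forall n \near \oo,
    [/\ forall G : graph n, (num_probes (A n) l G)%:R <= n%:R `^ delta,
        forall G : graph n, is_clique G (output (A n) l G) &
        1 / 2 <= Gnp_pr (1 / 2 : R)
          (fun G : graph n => alpha * log2 n%:R <= #|output (A n) l G|%:R)].

Definition alpha_star (R : realType) (delta : R) (l : nat) : \bar R :=
  ereal_sup [set alpha%:E | alpha in achievable delta l].

(* Main.v *)
Require Import Defs.
From mathcomp Require Import all_boot all_order all_algebra.
From mathcomp Require Import all_classical all_reals all_analysis.
From mathcomp Require Import ring lra zify.
(* Restores the finite-set meaning of names such as set0 and subsetP. *)
From mathcomp Require Import fintype finset.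
Import Order.TTheory GRing.Theory Num.Theory.

Local Open Scope ring_scope.

(** Write c = 1 - delta/2, so that the target 1 + delta/2 is c + delta.
    The first round probes all pairs inside a block of about n^(c/2) vertices;
    the largest clique of a random graph on m vertices has about 2 log m
    vertices, so this yields a clique C (the seed) of c log n vertices.  The
    second round probes all pairs between C and a disjoint block of about n
    vertices; a vertex is adjacent to all of C with probability n^(-c), so
    about n^(1-c) = n^(delta/2) vertices are common neighbours of C.  The third
    round probes all pairs inside a set W of that many common neighbours (the
    arena), which costs about n^delta probes, and finds in W a clique of about
    2 log n^(delta/2) = delta log n vertices.  Together with C it is a clique of
    about (c + delta) log n vertices.  Lowering every exponent by a multiple of
    a small g > 0 makes room for the polylogarithmic factors, at the price of
    reaching only 1 + delta/2 - 4 g; the supremum over g closes the gap.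

    The bound on the number of probes and the correctness of the output hold on
    every graph, not just on typical ones: the probed sets have bounded size
    whatever the answers are, and the output is a largest set of vertices all
    of whose pairs have been seen to be edges.

    Both probabilistic inputs, the existence of large cliques
    ([prob_no_clique]) and of many common neighbours
    ([prob_few_common_nbrs]), are instances of one second-moment bound,
    [second_moment_contains], for the number of members of a family of edge
    sets that a random graph contains.  They speak of a fixed vertex set,
    whereas C and W depend on the graph; but C and W are determined by pairs
    disjoint from those on which the next round relies, and
    [prob_resample_le] turns this into a licence to treat them as fixed.  Each
    of the three rounds then fails with probability at most 1/8, and
    3/8 < 1/2. *)

(** * The uniform distribution on a finite type *)

Definition mean {R : realFieldType} {T : finType} (f : T -> R) : R :=
  (\sum_t f t) / #|T|%:R.

Definition prob (R : realFieldType) {T : finType} (P : pred T) : R :=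
  mean (fun t => (P t)%:R).

Lemma mean_le {R : realFieldType} {T : finType} (f g : T -> R) :
  (forall t, f t <= g t) -> mean f <= mean g.
Proof.
by move=> fg; rewrite /mean ler_wpM2r ?invr_ge0 ?ler0n//; apply: ler_sum.
Qed.

Lemma eq_mean {R : realFieldType} {T : finType} (f g : T -> R) :
  f =1 g -> mean f = mean g.
Proof. by move=> fg; congr (_ / _); apply: eq_bigr => t _; apply: fg. Qed.

Lemma meanD {R : realFieldType} {T : finType} (f g : T -> R) :
  mean (fun t => f t + g t) = mean f + mean g.
Proof. by rewrite /mean big_split/= mulrDl. Qed.

Lemma meanZ {R : realFieldType} {T : finType} (c : R) (f : T -> R) :
  mean (fun t => c * f t) = c * mean f.
Proof. by rewrite /mean -mulr_sumr mulrA. Qed.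

Lemma mean_sum {R : realFieldType} {T I : finType} (A : {set I})
    (f : I -> T -> R) :
  mean (fun t => \sum_(i in A) f i t) = \sum_(i in A) mean (f i).
Proof. by rewrite /mean exchange_big/= mulr_suml. Qed.

Lemma mean_const {R : realFieldType} {T : finType} (t0 : T) (c : R) :
  mean (fun _ : T => c) = c.
Proof.
rewrite /mean sumr_const -[c *+ _]mulr_natr mulfK// pnatr_eq0.
by apply/eqP => /card0_eq/(_ t0).
Qed.

Lemma prob_le {R : realFieldType} {T : finType} (P Q : pred T) :
  (forall t, P t -> Q t) -> prob R P <= prob R Q.
Proof.
move=> PQ; apply: mean_le => t; rewrite ler_nat.
by case: (P t) (PQ t) => // ->.
Qed.

Lemma probU_le {R : realFieldType} {T : finType} (P Q : pred T) :
  prob R (fun t => P t || Q t) <= prob R P + prob R Q.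
Proof.
rewrite /prob -meanD; apply: mean_le => t; rewrite -natrD ler_nat.
by case: (P t); case: (Q t).
Qed.

(** Chebyshev's inequality: the hypothesis bounds the variance by
    [eta * mu ^+ 2], and the event is a deviation of more than [mu / 2]. *)
Lemma chebyshev_lower_half {R : realFieldType} {T : finType} (X : T -> R)
    (mu eta : R) : 0 < mu -> mean X = mu ->
  mean (fun t => X t ^+ 2) <= (1 + eta) * mu ^+ 2 ->
  prob R (fun t => X t < mu / 2) <= 4 * eta.
Proof.
move=> mu0 EX EX2.
have [t0 _|T0] := pickP (fun _ : T => true); last first.
  by move: mu0; rewrite -EX /mean big_pred0 ?mul0r ?ltxx.
have pw t : (X t < mu / 2)%R%:R <=
    4 / mu ^+ 2 * (X t ^+ 2 + (- (2 * mu) * X t + mu ^+ 2)).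
  rewrite mulrAC ler_pdivlMr ?exprn_gt0//.
  case: ltP => [h|_] /=; last first.
    by have := sqr_ge0 (X t - mu); rewrite mul0r; nra.
  (* Their product is [4 * (X t - mu) ^+ 2 - mu ^+ 2]. *)
  have h1 : 0 < mu - 2 * X t by lra.
  have h2 : 0 < 3 * mu - 2 * X t by lra.
  by have := mulr_gt0 h1 h2; rewrite mul1r; nra.
apply: le_trans (mean_le _ _ pw) _.
rewrite meanZ meanD meanD meanZ EX mean_const//.
rewrite mulrAC ler_pdivrMr ?exprn_gt0//; nra.
Qed.

(** * Random subsets of a finite set *)

Lemma card_supersets {E : finType} (F : {set E}) :
  #|[set G : {set E} | F \subset G]| = (2 ^ (#|E| - #|F|))%N.
Proof.
have -> : (#|E| - #|F|)%N = #|(~: F)%SET| by rewrite -(cardsC F) addKn.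
rewrite -card_powerset -[LHS](card_imset _ (can_inj (@setCK E))).
apply: eq_card => G; rewrite powersetE; apply/imsetP/idP => [[H]|GF].
  by rewrite inE => FH ->; rewrite setCS.
by exists (~: G)%SET; rewrite ?setCK// inE -setCS setCK.
Qed.

Lemma prob_card {R : realFieldType} {T : finType} (P : pred T) :
  prob R P = #|[set t | P t]|%:R / #|T|%:R.
Proof.
congr (_ / _); rewrite -natr_sum -sum1_card [in RHS]big_mkcond/=; congr _%:R.
by apply: eq_bigr => t _; rewrite inE; case: (P t).
Qed.

Lemma card_set {E : finType} : #|{set E}| = (2 ^ #|E|)%N.
Proof. by have := card_powerset [set: E]; rewrite powersetT !cardsT. Qed.

Lemma Gnp_pr_half (R : realType) {n : nat} (P : pred (graph n)) :
  Gnp_pr (1 / 2 : R) P = prob R P.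
Proof.
rewrite prob_card card_set /Gnp_pr.
rewrite (eq_bigr (fun=> (1 / 2) ^+ #|{: vpair n}|)) => [|G _]; last first.
  rewrite -prodr_const; apply: eq_bigr => e _; case: ifP => // _; lra.
rewrite sumr_const -[LHS]mulr_natl natrX expr_div_n expr1n mul1r.
by congr (_%:R / _); apply: eq_card => G; rewrite inE.
Qed.

Lemma prob_contains {R : realFieldType} {E : finType} (F : {set E}) :
  prob R (fun G : {set E} => F \subset G) = 2 ^- #|F|.
Proof.
rewrite prob_card card_supersets card_set !natrX.
rewrite -[X in _ / _ ^+ X](subnK (max_card (mem F))) exprD invfM.
by rewrite mulVKf// expf_neq0// pnatr_eq0.
Qed.

(** Two members are both contained in a random set with probability
    [2 ^- #|F i :|: F j|], which exceeds the independent value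
    [2 ^- f * 2 ^- f] by the factor [2 ^+ #|F i :&: F j|].  So the hypothesis
    that this factor is at most [1 + eta] on average over [j] says that the
    second moment of the number of contained members is at most [1 + eta]
    times the square of its mean, which is [#|A|%:R * 2 ^- f]. *)
Lemma second_moment_contains {R : realFieldType} {E I : finType}
    (A : {set I}) (F : I -> {set E}) (f : nat) (eta : R) (i0 : I) :
    i0 \in A ->
    (forall i, i \in A -> #|F i| = f) ->
    (forall i, i \in A ->
       \sum_(j in A) 2 ^+ #|(F i :&: F j)%SET| <= (1 + eta) * #|A|%:R) ->
  prob R (fun G : {set E} =>
    #|[set i in A | F i \subset G]|%:R < #|A|%:R * 2 ^- f / 2 :> R) <= 4 * eta.
Proof.
move=> i0A cF hF.
pose X (G : {set E}) : R := \sum_(i in A) (F i \subset G)%:R.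
have XE (G : {set E}) : #|[set i in A | F i \subset G]|%:R = X G.
  rewrite /X -natr_sum -sum1_card big_mkcond/= [in RHS]big_mkcond/=; congr _%:R.
  by apply: eq_bigr => i _; rewrite inE; case: (i \in A); case: (_ \subset _).
rewrite [prob _ _](_ : _ = prob R (fun G => X G < #|A|%:R * 2 ^- f / 2));
  last first.
  by apply: eq_mean => G; rewrite XE.
have A0 : 0 < #|A|%:R :> R by rewrite ltr0n; apply/card_gt0P; exists i0.
apply: (@chebyshev_lower_half _ _ X).
- by rewrite mulr_gt0// invr_gt0 exprn_gt0.
- rewrite mean_sum (eq_bigr (fun=> 2 ^- f)) => [|i iA]; last first.
    by rewrite -/(prob R _) prob_contains cF.
  by rewrite sumr_const mulr_natl.
have X2 (G : {set E}) : X G ^+ 2 =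
    \sum_(i in A) \sum_(j in A) ((F i :|: F j)%SET \subset G)%:R.
  rewrite expr2 mulr_suml; apply: eq_bigr => i _; rewrite mulr_sumr.
  by apply: eq_bigr => j _; rewrite subUset mulrC -mulnb natrM mulrC.
rewrite (eq_mean _ _ X2) mean_sum.
under eq_bigr => i _ do rewrite mean_sum.
have -> : (1 + eta) * (#|A|%:R * 2 ^- f) ^+ 2 =
    \sum_(i in A) ((2 ^- f) ^+ 2 * ((1 + eta) * #|A|%:R)).
  by rewrite sumr_const -[RHS]mulr_natl; ring.
apply: ler_sum => i iA; apply: le_trans (ler_wpM2l _ (hF i iA)); last first.
  by rewrite exprn_ge0// invr_ge0 exprn_ge0.
rewrite mulr_sumr; apply: ler_sum => j jA.
rewrite -/(prob R _) prob_contains.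
have := cardsUI (F i) (F j); rewrite !cF// => cUI.
by rewrite expr2 -invfM -exprD -cUI exprD invfM mulfVK ?expf_neq0 ?pnatr_eq0.
Qed.

(** * Resampling *)

(** The random set [G] after the part outside [D] has been drawn afresh. *)
Definition resample {E : finType} (D G G' : {set E}) : {set E} :=
  ((G :&: D) :|: (G' :\: D))%SET.

(** For independent uniform [G] and [G'], exchanging their parts outside [D]
    is an involution on the pairs [(G, G')]; hence the resampled set is again
    uniform. *)
Lemma mean_resample {R : realFieldType} {E : finType} (D : {set E})
    (f : {set E} -> R) :
  mean f = mean (fun G => mean (fun G' => f (resample D G G'))).
Proof.
rewrite /mean -[in RHS]mulr_suml pair_big/=.
(* Both components of [swap] are resampled sets, with the roles of the two
   arguments exchanged. *)
pose swap (p : {set E} * {set E}) := (resample D p.1 p.2, resample D p.2 p.1).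
have swapK : involutive swap.
  move=> [G G']; congr pair; apply/setP => e; rewrite !inE/=;
  by case: (e \in D); rewrite ?andbT ?andbF ?orbF.
rewrite -(reindex_inj (inv_inj swapK) (P := xpredT) (F := fun p => f p.1)).
rewrite -(pair_big xpredT xpredT (fun G _ => f G))/=.
under [in RHS]eq_bigr do rewrite sumr_const -mulr_natr.
rewrite -mulr_suml mulfK// pnatr_eq0.
by apply/eqP => /card0_eq/(_ set0).
Qed.

(** Conditioning on the part inside [D]: with [G] fixed, everything computed
    from [G :&: D] is a constant, and only [G'] is random. *)
Lemma prob_resample_le {R : realFieldType} {E : finType} (D : {set E})
    (P : pred {set E}) (eps : R) :
  (forall G, prob R (fun G' => P (resample D G G')) <= eps) -> prob R P <= eps.
Proof.
move=> hP; rewrite /prob (mean_resample D).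
by apply: le_trans (mean_le _ _ hP) _; rewrite (mean_const set0).
Qed.

Lemma setI_resample {E : finType} (D F G G' : {set E}) : F \subset D ->
  (F :&: resample D G G' = F :&: G)%SET.
Proof.
move=> FD; apply/setP => e; rewrite !inE.
by case: (boolP (e \in F)) => //= /(subsetP FD) ->; rewrite andbT orbF.
Qed.

Lemma sub_resampleC {E : finType} (D F G G' : {set E}) : [disjoint F & D] ->
  (F \subset resample D G G') = (F \subset G').
Proof.
move=> FD; apply/subsetP/subsetP => h e eF; have := h e eF;
  by rewrite !inE (disjointFr FD eF) andbF.
Qed.

(** * Counting the sets that contain a given set *)

(** Expanding the product of [1 + z] over the elements of [A] gives one term
    for each subset. *)
Lemma sum_subsets_expr {R : realFieldType} {T : finType} (A : {set T}) (z : R) :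
  \sum_(J : {set T} | J \subset A) z ^+ #|J| = (1 + z) ^+ #|A|.
Proof.
transitivity (\prod_(i : T) ((if i \in A then z else 0) + 1)); last first.
  rewrite (eq_bigr (fun i => if i \in A then 1 + z else 1)) => [|i _].
    by rewrite -big_mkcond/= prodr_const.
  by case: (i \in A); rewrite ?add0r// addrC.
rewrite bigA_distr big_mkcond/=; apply: eq_bigr => J _.
case: ifPn => [JA|/subsetPn[i iJ iA]]; last first.
  by rewrite (bigD1 i)//= iJ (negPf iA) mul0r.
rewrite -prodr_const big_mkcond/=; apply: eq_bigr => i _.
by case: ifPn => // iJ; rewrite (subsetP JA).
Qed.

(** The quotient of the binomials is the product of the [(k - i) / (w - i)]
    for [i < j], and each factor is at most [k / w]. *)
Lemma bin_sub_le (w k j : nat) : (j <= k <= w)%N ->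
  ('C(w - j, k - j) * w ^ j <= k ^ j * 'C(w, k))%N.
Proof.
elim: j => [|j IH] /andP[jk kw]; first by rewrite !subn0 !expn0 muln1 mul1n.
have {}IH := IH _; rewrite (ltnW jk) kw in IH; have {}IH := IH isT.
have wj : (0 < w - j)%N by lia.
have D : ((w - j) * 'C(w - j.+1, k - j.+1) = (k - j) * 'C(w - j, k - j))%N.
  have -> : (w - j.+1 = (w - j).-1)%N by lia.
  by rewrite mul_bin_diag; congr (_ * 'C(_, _))%N; lia.
have st : ('C(w - j.+1, k - j.+1) * w <= k * 'C(w - j, k - j))%N.
  rewrite -(leq_pmul2l wj) mulnA D mulnAC mulnCA mulnA leq_mul2r.
  by apply/orP; right; nia.
rewrite !expnS mulnA; apply: leq_trans (leq_mul st (leqnn _)) _.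
by rewrite -!mulnA leq_mul2l IH orbT.
Qed.

Lemma card_draws_containing {T : finType} (W J : {set T}) (k : nat) :
  (#|[set B : {set T} | [&& J \subset B, B \subset W & #|B| == k]]| <=
    'C(#|W| - #|J|, k - #|J|))%N.
Proof.
have [JW|nJW] := boolP (J \subset W); last first.
  rewrite (_ : [set B | _] = set0) ?cards0//; apply/setP => B; rewrite !inE.
  apply/negP => /and3P[JB BW _]; case/negP: nJW; exact: subset_trans JB BW.
have <- : #|W :\: J| = (#|W| - #|J|)%N by rewrite cardsDS.
rewrite -cards_draws -(card_in_imset (f := fun B => B :\: J)%SET); last first.
  move=> B1 B2; rewrite !inE => /andP[J1 _] /andP[J2 _] e.
  by rewrite -(setID B1 J) -(setID B2 J) e (setIidPr J1) (setIidPr J2).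
apply/subset_leq_card/subsetP => _ /imsetP[B + ->].
rewrite !inE => /and3P[JB BW /eqP <-].
by rewrite setSD//= cardsDS.
Qed.

(** The size of the overlap is awkward to handle exactly, so
    [y ^+ #|A :&: B|] is bounded by the sum of [y ^+ #|J|] over all subsets [J]
    of the overlap.  After exchanging the sums, each [J] is contained in a
    fraction of at most [(k / #|W|) ^ #|J|] of the sets [B], and the sum over
    [J] is the expansion of a power of a binomial. *)
Lemma sum_draws_expr_meet {R : realFieldType} {T : finType} (W A : {set T})
    (k : nat) (y : R) : 0 <= y -> (k <= #|W|)%N -> #|A| = k ->
  \sum_(B in [set B : {set T} | (B \subset W) && (#|B| == k)])
      y ^+ #|(A :&: B)%SET| <=
    (1 + y * k%:R / #|W|%:R) ^+ k *
    #|[set B : {set T} | (B \subset W) && (#|B| == k)]|%:R.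
Proof.
move=> y0 kW Ak; set D := finset _.
have [k0|kpos] := posnP k.
  rewrite [leRHS](_ : _ = \sum_(B in D) 1); last first.
    by rewrite k0 expr0 mul1r sumr_const.
  apply: ler_sum => B _; rewrite (_ : (A :&: B)%SET = set0) ?cards0//.
  by have := Ak; rewrite k0 => /cards0_eq ->; rewrite set0I.
have W0 : 0 < #|W|%:R :> R by rewrite ltr0n (leq_trans kpos).
apply: le_trans
  (_ : \sum_(B in D) \sum_(J : {set T} | J \subset A :&: B) y ^+ #|J| <= _).
  apply: ler_sum => B _; rewrite (bigD1 (A :&: B)%SET)//= lerDl.
  by apply: sumr_ge0 => J _; apply: exprn_ge0.
rewrite (exchange_big_dep (fun J : {set T} => J \subset A))/=; last first.
  by move=> B J _; rewrite subsetI => /andP[].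
rewrite -[in X in (_ + _) ^+ X]Ak -sum_subsets_expr mulr_suml.
apply: ler_sum => J JA.
rewrite sumr_const -[leLHS]mulr_natr -[_ * _ / _]mulrA exprMn -mulrA.
rewrite ler_wpM2l ?exprn_ge0//.
rewrite expr_div_n mulrAC ler_pdivlMr ?exprn_gt0// -!natrX -!natrM ler_nat.
have jk : (#|J| <= k)%N by rewrite -Ak subset_leq_card.
have := @bin_sub_le #|W| k #|J|; rewrite jk kW => /(_ isT).
rewrite {2}/D cards_draws; apply: leq_trans; rewrite leq_mul2r.
apply/orP; right; apply: leq_trans (card_draws_containing W J k).
apply/subset_leq_card/subsetP => B.
by rewrite unfold_in/= !inE subsetI => /andP[/andP[-> ->] /andP[_ ->]].
Qed.

Lemma expr1D_le {R : realFieldType} (r : R) (k : nat) : 0 <= r ->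
  k%:R * r <= 1 / 2 -> (1 + r) ^+ k <= 1 + 2 * (k%:R * r).
Proof.
move=> r0; elim: k => [|k IH]; first by rewrite expr0 mul0r mulr0 addr0.
rewrite -natr1 => kr; rewrite exprS.
have {}IH : (1 + r) ^+ k <= 1 + 2 * (k%:R * r) by apply: IH; lra.
have k0 : 0 <= k%:R :> R by [].
apply: le_trans (ler_wpM2l _ IH) _; nra.
Qed.

(** * Cliques *)

Definition pairs_in {n : nat} (X : {set 'I_n}) : {set vpair n} :=
  [set e | ((val e).1 \in X) && ((val e).2 \in X)].

Lemma pairs_inI {n : nat} (X Y : {set 'I_n}) :
  (pairs_in X :&: pairs_in Y)%SET = pairs_in (X :&: Y)%SET.
Proof. by apply/setP => e; rewrite !inE andbACA. Qed.

Lemma pairs_inS {n : nat} (X Y : {set 'I_n}) :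
  X \subset Y -> pairs_in X \subset pairs_in Y.
Proof.
move=> /subsetP XY; apply/subsetP => e.
by rewrite !inE => /andP[/XY -> /XY ->].
Qed.

(** An ordered pair of elements of [X] is increasing, decreasing or
    constant. *)
Lemma card_pairs_in {n : nat} (X : {set 'I_n}) :
  (#|pairs_in X|.*2 + #|X| = #|X| ^ 2)%N.
Proof.
have P : #|pairs_in X| = (\sum_(x in X) \sum_(y in X) (x < y))%N.
  rewrite -(card_imset _ val_inj) pair_big/= -sum1_card.
  rewrite big_mkcond [RHS]big_mkcond/=; apply: eq_bigr => -[x y] _ /=.
  case: imsetP => [[e]|/=].
    rewrite inE; case: e => -[a b] /= ab /andP[aX bX] [-> ->].
    by rewrite aX bX ab.
  case: ifP => // /andP[xX yX]; case: ltnP => // xy [].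
  exists (exist _ (x, y) xy) => //.
  by rewrite inE/= xX.
have D : #|X| = (\sum_(x in X) \sum_(y in X) (x == y))%N.
  rewrite -sum1_card; apply: eq_bigr => x xX.
  rewrite (bigD1 x)//= eqxx big1 ?addn0// => y /andP[_ yx].
  by rewrite eq_sym (negPf yx).
have Q : #|pairs_in X| = (\sum_(x in X) \sum_(y in X) (y < x))%N.
  by rewrite P exchange_big.
rewrite -addnn {1}P Q {1}D -mulnn -sum_nat_const -!big_split/=.
apply: eq_bigr => x _; rewrite -sum1_card -!big_split/=; apply: eq_bigr => y _.
by rewrite -(inj_eq val_inj)/=; case: ltngtP.
Qed.

Definition has_clique {n : nat} (G : graph n) (W : {set 'I_n}) (k : nat) :=
  [exists B : {set 'I_n}, [&& B \subset W, #|B| == k & pairs_in B \subset G]].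

Lemma has_cliqueI {n : nat} (G : graph n) W k :
  has_clique (pairs_in W :&: G)%SET W k = has_clique G W k.
Proof.
apply: eq_existsb => B; case: (boolP (B \subset W)) => //= BW.
by rewrite subsetI pairs_inS.
Qed.

(** Up to a factor polynomial in [h], a random graph on [2 ^ h] vertices is
    large enough for a clique of size [k = 2 h].  With [w] for the value, the
    factor [256 * h.+1 ^ 2] makes [k * (2 ^ h * k / w)] at most 1/64, and the
    successor keeps [w] positive at [h = 0]. *)
Definition clique_room (h : nat) : nat := (256 * h.+1 ^ 2 * 2 ^ h)%N.

(** The second-moment bound for the sets of pairs of the [k]-subsets of [W],
    where [k = 2 h].  An overlap of [j <= k] vertices shares [j (j - 1) / 2]
    pairs, which is at most [h j]; this linear bound makes
    [sum_draws_expr_meet] applicable with [y = 2 ^ h]. *)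
Lemma prob_no_clique (R : realFieldType) {n : nat} (W : {set 'I_n}) (h : nat) :
  (clique_room h <= #|W|)%N ->
  prob R (fun G => ~~ has_clique G W h.*2) <= 1 / 8.
Proof.
move=> hW; set k := h.*2.
have P2 : (0 < 2 ^ h)%N by rewrite expn_gt0.
have hW' : (256 * h.+1 ^ 2 * 2 ^ h <= #|W|)%N by [].
have kW : (k <= #|W|)%N by rewrite /k; nia.
pose D := [set B : {set 'I_n} | (B \subset W) && (#|B| == k)].
have D0 : (0 < #|D|)%N by rewrite cards_draws bin_gt0.
have /card_gt0P[B0 B0D] := D0.
have cP (B : {set 'I_n}) : B \in D -> #|pairs_in B| = #|pairs_in B0|.
  move: B0D; rewrite !inE => /andP[_ /eqP c0] /andP[_ /eqP cB].
  by have := card_pairs_in B; have := card_pairs_in B0; rewrite c0 cB; lia.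
have := @second_moment_contains R _ _ D pairs_in _ (1 / 32) B0 B0D cP.
set m := (X in X / 2) => sm.
apply: le_trans (_ : 4 * (1 / 32) <= _); last by lra.
apply: le_trans (sm _); last first.
  move=> A AD; have Ak : #|A| = k by move: AD; rewrite inE => /andP[_ /eqP].
  apply: le_trans (_ : \sum_(B in D) (2 ^+ h) ^+ #|(A :&: B)%SET| <= _).
    apply: ler_sum => B _; rewrite pairs_inI -exprM.
    apply: ler_weXn2l; first by rewrite ler1n.
    have := card_pairs_in (A :&: B)%SET.
    have : (#|(A :&: B)%SET| <= k)%N by rewrite -Ak subset_leq_card// subsetIl.
    by rewrite /k; nia.
  apply: le_trans (@sum_draws_expr_meet R _ W A k (2 ^+ h) _ kW Ak) _.
    exact: exprn_ge0.
  rewrite ler_wpM2r//.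
  have W0 : 0 < #|W|%:R :> R by rewrite ltr0n; nia.
  have kr : k%:R * (2 ^+ h * k%:R / #|W|%:R) <= 1 / 64 :> R.
    rewrite mulrA ler_pdivrMr// mulrAC ler_pdivlMr// -!natrX -!natrM.
    by rewrite mul1r ler_nat /k; nia.
  apply: le_trans (@expr1D_le R _ k _ _) _.
  - by rewrite divr_ge0// mulr_ge0// exprn_ge0.
  - by apply: le_trans kr _; lra.
  - by lra.
apply: prob_le => G; rewrite negb_exists => /forallP noB.
rewrite (_ : [set i in D | _] = set0); last first.
  by apply/setP => B; rewrite !inE -andbA; apply: negbTE.
by rewrite cards0 divr_gt0// mulr_gt0 ?ltr0n// invr_gt0 exprn_gt0.
Qed.

(** * Common neighbours *)

Definition star {n : nat} (C : {set 'I_n}) (v : 'I_n) : {set vpair n} :=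
  [set e | ((val e).1 \in C) && ((val e).2 == v)].

Definition common_nbrs {n : nat} (G : graph n) (C T : {set 'I_n}) :=
  [set v in T | star C v \subset G].

(** The stars from distinct vertices of [T] to [C] are disjoint, so in the
    second-moment bound only the term [j = i] exceeds 1, and it is at most
    [#|T| / (2 w)].  The expected number of common neighbours is at least
    [2 w], twice the number wanted. *)
Lemma prob_few_common_nbrs (R : realFieldType) {n : nat} (C T : {set 'I_n})
    (w : nat) :
  (forall x v, x \in C -> v \in T -> (x < v)%N) ->
  (16 <= w)%N -> (2 * w * 2 ^ #|C| <= #|T|)%N ->
  prob R (fun G => (#|common_nbrs G C T| < w)%N) <= 1 / 8.
Proof.
move=> CT w16 wT.
have cP v : v \in T -> #|star C v| = #|C|.
  move=> vT; rewrite -(card_imset _ val_inj) -[RHS]muln1 -(cards1 v) -cardsX.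
  apply: eq_card => -[x y]; rewrite !inE/=; apply/imsetP/andP.
    move=> [[[a b] /= ab]]; rewrite inE/= => /andP[aC /eqP ->] [-> ->].
    by rewrite aC eqxx.
  move=> [xC /eqP ->]; exists (exist _ (x, v) (CT x v xC vT)) => //.
  by rewrite inE/= xC eqxx.
have C0 : (0 < 2 ^ #|C|)%N by rewrite expn_gt0.
have /card_gt0P[v0 v0T] : (0 < #|T|)%N by nia.
have T0 : 0 < #|T|%:R :> R by rewrite ltr0n; nia.
have := @second_moment_contains R _ _ T (star C) _ (1 / 32) v0 v0T cP.
set m := (X in X / 2) => sm.
apply: le_trans (_ : 4 * (1 / 32) <= _); last by lra.
apply: le_trans (sm _); last first.
  move=> v vT; rewrite (bigD1 v)//= setIid cP//.
  rewrite (eq_bigr (fun=> 1)) => [|u /andP[_ uv]]; last first.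
    rewrite (_ : (_ :&: _)%SET = set0) ?cards0//; apply/setP => e; rewrite !inE.
    apply/negP => /andP[/andP[_ /eqP ev] /andP[_ /eqP eu]].
    by rewrite -ev -eu eqxx in uv.
  apply: le_trans (_ : 2 ^+ #|C| + \sum_(u in T) 1 <= _).
    by rewrite lerD2l [leRHS](bigD1 v)//= lerDr.
  rewrite sumr_const mulrDl mul1r addrC lerD2l mulrAC ler_pdivlMr// mul1r.
  rewrite -natrX -natrM ler_nat; apply: leq_trans wT.
  by rewrite mulnC leq_mul2r; apply/orP; right; lia.
apply: prob_le => G /= few.
rewrite ltr_pdivlMr// ltr_pdivlMr ?exprn_gt0// -natrX -!natrM ltr_nat.
apply: leq_trans wT; rewrite ltn_mul2r C0/= mulnC ltn_mul2l/=.
exact: few.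
Qed.

(** * Building blocks of the algorithm *)

Lemma card_ord_interval {n : nat} (a b : nat) : (a + b <= n)%N ->
  #|[set v : 'I_n | (a <= v < a + b)%N]| = b.
Proof.
move=> abn; have lt (i : 'I_b) : (a + i < n)%N.
  by apply: leq_trans abn; rewrite ltn_add2l.
rewrite -[RHS]card_ord -(card_imset (f := fun i : 'I_b => Ordinal (lt i))).
  apply: eq_card => v; rewrite !inE.
  apply/idP/imsetP => [/andP[av vb]|[i _ ->]/=].
    have vb' : (v - a < b)%N by rewrite ltn_subLR.
    by exists (Ordinal vb') => //; apply: val_inj; rewrite /= subnKC.
  by rewrite leq_addr ltn_add2l /=.
by move=> i j [] /addnI /val_inj.
Qed.

Definition pairs_between {n : nat} (X Y : {set 'I_n}) : {set vpair n} :=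
  [set e | ((val e).1 \in X) && ((val e).2 \in Y)].

Lemma card_pairs_between {n : nat} (X Y : {set 'I_n}) :
  (#|pairs_between X Y| <= #|X| * #|Y|)%N.
Proof.
rewrite -cardsX -(card_imset _ val_inj); apply/subset_leq_card/subsetP.
by move=> _ /imsetP[e + ->]; rewrite !inE.
Qed.

Definition pick_clique {n : nat} (K : graph n) (W : {set 'I_n}) (k : nat) :=
  odflt set0
    [pick B : {set 'I_n} | [&& B \subset W, #|B| == k & pairs_in B \subset K]].

Lemma pick_clique_sub {n : nat} (K : graph n) W k : pick_clique K W k \subset W.
Proof.
by rewrite /pick_clique; case: pickP => [B /and3P[]|_] //=; rewrite sub0set.
Qed.

Lemma card_pick_clique {n : nat} (K : graph n) W k :
  (#|pick_clique K W k| <= k)%N.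
Proof.
rewrite /pick_clique; case: pickP => [B /and3P[_ /eqP ->]|_] //=.
by rewrite cards0.
Qed.

Lemma pick_cliqueP {n : nat} (K : graph n) W k : has_clique K W k ->
  #|pick_clique K W k| = k /\ pairs_in (pick_clique K W k) \subset K.
Proof.
rewrite /pick_clique => /existsP[B hB].
by case: pickP => [B' /and3P[_ /eqP]|/(_ B)] //=; rewrite hB.
Qed.

Definition truncate_set {n : nat} (w : nat) (X : {set 'I_n}) : {set 'I_n} :=
  [set x in take w (enum X)].

Lemma truncate_set_sub {n : nat} w (X : {set 'I_n}) :
  truncate_set w X \subset X.
Proof. by apply/subsetP => x; rewrite inE => /mem_take; rewrite mem_enum. Qed.

Lemma card_truncate_set {n : nat} w (X : {set 'I_n}) :
  #|truncate_set w X| = minn w #|X|.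
Proof.
by rewrite cardsE (card_uniqP _) ?take_uniq ?enum_uniq// size_take_min -cardE.
Qed.

(** * The three-round algorithm *)

(** Throughout, [h1] and [h] are half the sizes of the cliques sought in the
    first and in the third round.  The lower bound 0 and the sum with 0 give
    both blocks the form that [card_ord_interval] counts. *)
Definition block1 (n h1 : nat) : {set 'I_n} :=
  [set v : 'I_n | (0 <= v < 0 + clique_room h1)%N].

(** A vertex is adjacent to all of a [2 h1]-set with probability
    [2 ^- h1.*2]; the factor 2 makes half the expected number of common
    neighbours equal to [clique_room h]. *)
Definition nbr_room (h1 h : nat) : nat := (2 * clique_room h * 2 ^ h1.*2)%N.

Definition block2 (n h1 h : nat) : {set 'I_n} :=
  [set v : 'I_n | (clique_room h1 <= v < clique_room h1 + nbr_room h1 h)%N].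

(** Here [K1] is the set of edges found in the first round.  If they contain no
    clique of the size wanted, the seed is empty and the later rounds go on
    regardless. *)
Definition seed (n h1 : nat) (K1 : graph n) : {set 'I_n} :=
  pick_clique K1 (block1 n h1) h1.*2.

(** The truncation bounds the cost of the third round on every graph. *)
Definition arena (n h1 h : nat) (K1 K2 : graph n) : {set 'I_n} :=
  truncate_set (clique_room h)
    (common_nbrs K2 (seed n h1 K1) (block2 n h1 h)).

Definition best_clique {n : nat} (K : graph n) : {set 'I_n} :=
  [arg max_(X > set0 | pairs_in X \subset K) #|X|]%N.

Definition three_rounds (n h1 h : nat) : algorithm n := {|
  query hist := match hist with
    | [::] => pairs_in (block1 n h1)
    | [:: r1] => pairs_between (seed n h1 r1.2) (block2 n h1 h)
    | [:: r1; r2] => pairs_in (arena n h1 h r1.2 r2.2)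
    | _ => set0
    end;
  result hist := best_clique (\bigcup_(r <- hist) r.2)%SET |}.

Lemma best_cliqueP {n : nat} (K : graph n) :
  pairs_in (best_clique K) \subset K /\
  forall X : {set 'I_n}, pairs_in X \subset K -> (#|X| <= #|best_clique K|)%N.
Proof.
rewrite /best_clique; case: arg_maxnP => [|X XK max].
  by apply/subsetP => e; rewrite !inE.
by split.
Qed.

Lemma blocks_lt {n h1 h : nat} (x v : 'I_n) :
  x \in block1 n h1 -> v \in block2 n h1 h -> (x < v)%N.
Proof. by rewrite !inE add0n => /= xs /andP[sv _]; apply: leq_trans sv. Qed.

(** The seed and the arena as functions of the input graph, for the analysis;
    the algorithm itself sees only the probed part of it. *)
Definition seed_of (n h1 : nat) (G : graph n) : {set 'I_n} :=
  seed n h1 (pairs_in (block1 n h1) :&: G)%SET.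

Definition arena_of (n h1 h : nat) (G : graph n) : {set 'I_n} :=
  arena n h1 h (pairs_in (block1 n h1) :&: G)%SET
    (pairs_between (seed_of n h1 G) (block2 n h1 h) :&: G)%SET.

Lemma run_three_rounds (n h1 h : nat) (G : graph n) :
  run (three_rounds n h1 h) 3 G =
  [:: (pairs_in (block1 n h1), pairs_in (block1 n h1) :&: G)%SET;
      (pairs_between (seed_of n h1 G) (block2 n h1 h),
        pairs_between (seed_of n h1 G) (block2 n h1 h) :&: G)%SET;
      (pairs_in (arena_of n h1 h G), pairs_in (arena_of n h1 h G) :&: G)%SET].
Proof. by []. Qed.

Lemma seed_sub (n h1 : nat) (G : graph n) : seed_of n h1 G \subset block1 n h1.
Proof. exact: pick_clique_sub. Qed.

Lemma common_nbrsI {n : nat} (G : graph n) (C T : {set 'I_n}) :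
  common_nbrs (pairs_between C T :&: G)%SET C T = common_nbrs G C T.
Proof.
apply/setP => v; rewrite !inE; case: (boolP (v \in T)) => //= vT.
rewrite subsetI; case: (_ \subset G); rewrite ?andbF// andbT.
by apply/subsetP => e; rewrite !inE => /andP[-> /eqP ->].
Qed.

Lemma arena_ofE (n h1 h : nat) (G : graph n) : arena_of n h1 h G =
  truncate_set (clique_room h)
    (common_nbrs G (seed_of n h1 G) (block2 n h1 h)).
Proof. by rewrite /arena_of /arena common_nbrsI. Qed.

Lemma arena_sub (n h1 h : nat) (G : graph n) :
  arena_of n h1 h G \subset common_nbrs G (seed_of n h1 G) (block2 n h1 h).
Proof. by rewrite arena_ofE truncate_set_sub. Qed.

(** * Cost and correctness on every graph *)

Lemma num_probes_three_rounds (n h1 h : nat) (G : graph n) :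
  (clique_room h1 + nbr_room h1 h <= n)%N ->
  (num_probes (three_rounds n h1 h) 3 G <=
    clique_room h1 ^ 2 + h1.*2 * nbr_room h1 h + clique_room h ^ 2)%N.
Proof.
move=> stn; rewrite /num_probes run_three_rounds !big_cons big_nil addn0 addnA.
have pin (X : {set 'I_n}) m : (#|X| <= m)%N -> (#|pairs_in X| <= m ^ 2)%N.
  move=> Xm; apply: leq_trans (_ : #|X| ^ 2 <= _)%N; last by rewrite leq_exp2r.
  by rewrite -card_pairs_in -addnn -addnA leq_addr.
rewrite !leq_add//=.
- apply: pin; rewrite card_ord_interval//.
  by apply: leq_trans stn; rewrite add0n leq_addr.
- apply: leq_trans (card_pairs_between _ _) _.
  by rewrite leq_mul// ?card_pick_clique// card_ord_interval.
- by apply: pin; rewrite card_truncate_set geq_minl.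
Qed.

Lemma output_is_clique (n h1 h : nat) (G : graph n) :
  is_clique G (output (three_rounds n h1 h) 3 G).
Proof.
move=> e e1 e2; rewrite /output run_three_rounds /= in e1 e2.
set K := (\bigcup_(r <- _) _)%SET in e1 e2.
have KG : K \subset G.
  by rewrite /K !big_cons big_nil setU0 -!setIUl subsetIr.
apply: (subsetP KG); have [/subsetP bK _] := best_cliqueP K.
by apply: bK; rewrite inE e1.
Qed.

(** The two cliques together form a clique whose edges have all been seen: the
    pairs inside the seed in the first round, those between seed and arena in
    the second, those inside the arena in the third.  Every vertex of the first
    block precedes every vertex of the second, so each mixed pair has its
    smaller end in the seed and was probed. *)
Lemma output_large (n h1 h : nat) (G : graph n) :
  has_clique G (block1 n h1) h1.*2 ->
  has_clique G (arena_of n h1 h G) h.*2 ->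
  (h1.*2 + h.*2 <= #|output (three_rounds n h1 h) 3 G|)%N.
Proof.
rewrite -has_cliqueI => /pick_cliqueP; rewrite -/(seed _ _ _) -/(seed_of _ _ _).
move=> [cC CG] /existsP[B /and3P[BW /eqP cB BG]].
have /subsetP BN := subset_trans BW (arena_sub n h1 h G).
have /subsetP CS := seed_sub n h1 G.
have B2 v : v \in B -> v \in block2 n h1 h by move/BN; rewrite inE => /andP[].
rewrite /output run_three_rounds /=.
set K := (\bigcup_(r <- _) _)%SET; have [_ bK] := best_cliqueP K.
have CB : [disjoint seed_of n h1 G & B].
  rewrite -setI_eq0; apply/eqP/setP => v; rewrite !inE.
  apply/negP => /andP[/CS v1 /B2 v2].
  by have := blocks_lt _ _ v1 v2; rewrite ltnn.
have cCB : #|(seed_of n h1 G :|: B)%SET| = (h1.*2 + h.*2)%N.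
  by rewrite cardsU disjoint_setI0// cards0 subn0 cC cB.
rewrite -cCB; apply: bK; apply/subsetP => e.
rewrite /K !big_cons big_nil setU0 !in_setU !in_setI /=.
rewrite inE !in_setU => /andP[/orP[e1|e1] /orP[e2|e2]].
- have /(subsetP CG) : e \in pairs_in (seed_of n h1 G) by rewrite inE e1.
  by rewrite inE => ->.
- apply/orP; right; apply/orP; left; rewrite inE e1 B2//=.
  have := BN _ e2; rewrite inE => /andP[_ /subsetP]; apply.
  by rewrite inE e1 eqxx.
- by have := blocks_lt _ _ (CS _ e2) (B2 _ e1); rewrite ltnNge ltnW// (valP e).
- have eB : e \in pairs_in B by rewrite inE e1.
  apply/orP; right; apply/orP; right; rewrite (subsetP BG)// andbT.
  exact: (subsetP (pairs_inS _ _ BW)).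
Qed.

(** * Success probability *)

(** The seed is determined by the pairs inside the first block, and no star
    with centre in the second block contains such a pair. *)
Lemma prob_small_arena (R : realFieldType) (n h1 h : nat) :
  (clique_room h1 + nbr_room h1 h <= n)%N ->
  prob R (fun G : graph n =>
    (#|common_nbrs G (seed_of n h1 G) (block2 n h1 h)| < clique_room h)%N)
  <= 1 / 8.
Proof.
move=> stn; apply: (prob_resample_le (pairs_in (block1 n h1))) => G.
set C := seed_of n h1 G.
apply: le_trans
  (@prob_few_common_nbrs R n C (block2 n h1 h) (clique_room h) _ _ _).
- apply: prob_le => G'; rewrite {1}/seed_of setI_resample//.
  rewrite -/(seed_of _ _ _) -/C.
  suff -> :
    common_nbrs (resample (pairs_in (block1 n h1)) G G') C (block2 n h1 h) =
    common_nbrs G' C (block2 n h1 h) by [].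
  apply/setP => v; rewrite [LHS]inE [RHS]inE.
  case: (boolP (v \in _)) => //= v2; apply: sub_resampleC.
  rewrite -setI_eq0; apply/eqP/setP => e; rewrite [RHS]inE inE.
  apply/negP => /andP[].
  rewrite inE => /andP[_ /eqP ev]; rewrite inE => /andP[_]; rewrite ev => v1.
  by have := blocks_lt _ _ v1 v2; rewrite ltnn.
- by move=> x v /(subsetP (seed_sub _ _ _)); exact: blocks_lt.
- have h2 : (0 < 2 ^ h)%N by rewrite expn_gt0.
  by rewrite /clique_room; nia.
- by rewrite card_ord_interval// leq_mul2l leq_exp2l// card_pick_clique orbT.
Qed.

(** Seed and arena are determined by the pairs whose smaller end lies in the
    first block, and no pair inside the arena, a subset of the second
    block, is of this kind. *)
Lemma prob_no_clique_in_arena (R : realFieldType) (n h1 h : nat) :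
  prob R (fun G : graph n =>
    (clique_room h <= #|common_nbrs G (seed_of n h1 G) (block2 n h1 h)|)%N &&
    ~~ has_clique G (arena_of n h1 h G) h.*2) <= 1 / 8.
Proof.
pose D := (pairs_in (block1 n h1) :|:
           pairs_between (block1 n h1) (block2 n h1 h))%SET.
apply: (prob_resample_le D) => G.
have seedE G' : seed_of n h1 (resample D G G') = seed_of n h1 G.
  by rewrite /seed_of setI_resample// subsetUl.
have arenaE G' : arena_of n h1 h (resample D G G') = arena_of n h1 h G.
  rewrite /arena_of seedE setI_resample ?subsetUl// setI_resample//.
  apply/subsetP => e; rewrite inE => /andP[e1 e2].
  rewrite inE; apply/orP; right.
  by rewrite inE (subsetP (seed_sub _ _ _) _ e1).
have nbrsE G' :
    #|common_nbrs (resample D G G') (seed_of n h1 G) (block2 n h1 h)| =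
    #|common_nbrs G (seed_of n h1 G) (block2 n h1 h)|.
  rewrite -common_nbrsI setI_resample ?common_nbrsI//.
  apply/subsetP => e; rewrite inE => /andP[e1 e2].
  rewrite inE; apply/orP; right.
  by rewrite inE (subsetP (seed_sub _ _ _) _ e1).
have [big|small] := leqP (clique_room h)
    #|common_nbrs G (seed_of n h1 G) (block2 n h1 h)|; last first.
  apply: le_trans (_ : prob R (fun=> false) <= _).
    by apply: prob_le => G'; rewrite seedE nbrsE leqNgt small.
  by rewrite /prob (mean_const set0)/=; lra.
apply: le_trans (@prob_no_clique R n (arena_of n h1 h G) h _); last first.
  by rewrite arena_ofE card_truncate_set; move: big; lia.
apply: prob_le => G' /andP[_]; rewrite arenaE; apply: contra.
move=> /existsP[B /and3P[BW cB BG]]; apply/existsP; exists B; rewrite BW cB/=.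
rewrite sub_resampleC// -setI_eq0; apply/eqP/setP => e.
rewrite [RHS]inE inE; apply/negP => /andP[+ eD]; rewrite inE => /andP[e1 e2].
have B2 v : v \in B -> v \in block2 n h1 h.
  by move=> /(subsetP BW)/(subsetP (arena_sub _ _ _ _)); rewrite inE => /andP[].
have : (val e).1 \in block1 n h1.
  by move: eD; rewrite in_setU !inE -!andb_orr => /andP[].
by move=> /blocks_lt/(_ (B2 _ e1)); rewrite ltnn.
Qed.

Lemma three_rounds_success (R : realType) (n h1 h : nat) :
  (clique_room h1 + nbr_room h1 h <= n)%N ->
  1 / 2 <= Gnp_pr (1 / 2 : R) (fun G : graph n =>
    (h1.*2 + h.*2 <= #|output (three_rounds n h1 h) 3 G|)%N).
Proof.
move=> stn; rewrite Gnp_pr_half.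
set P := (X in prob _ X).
have p1 : 1 <= prob R P + prob R (fun G => ~~ P G).
  apply: le_trans (probU_le _ _).
  rewrite -{1}(mean_const (set0 : graph n) (1 : R)); apply: mean_le => G.
  by rewrite orbN.
have c1 : (clique_room h1 <= #|block1 n h1|)%N.
  by rewrite card_ord_interval//; apply: leq_trans stn; rewrite add0n leq_addr.
have b1 := prob_no_clique R (block1 n h1) h1 c1.
have b2 := prob_small_arena R n h1 h stn.
have b3 := prob_no_clique_in_arena R n h1 h.
suff : prob R (fun G => ~~ P G) <= 1 / 8 + (1 / 8 + 1 / 8) by lra.
apply: le_trans (lerD b1 (lerD b2 b3)).
apply: le_trans (lerD (lexx _) (probU_le _ _)).
apply: le_trans (probU_le _ _).
apply: prob_le => G; apply: contraR; rewrite !negb_or negbK -leqNgt.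
move=> /and3P[hs ha]; rewrite ha/= negbK => hc.
exact: output_large.
Qed.

(** * Choice of the parameters *)

(** From [1 - 1/2 <= expR (- (1/2))]. *)
Lemma ln2_ge_half (R : realType) : 1 / 2 <= ln 2 :> R.
Proof.
have e : expR (1 / 2) <= 2 :> R.
  have := expR_ge1Dx (- (1 / 2) : R); rewrite expRN => h.
  have e0 := expR_gt0 (1 / 2 : R).
  rewrite -(ler_pV2 (R := R)) ?inE ?unitf_gt0//; lra.
by rewrite -[leLHS]expRK ler_ln// posrE// expR_gt0.
Qed.

Lemma ln2_le1 (R : realType) : ln 2 <= 1 :> R.
Proof. by have := @le_ln1Dx R 1; apply; lra. Qed.

(** With [x = g u / 4], the right-hand side is [(expR x ^ 2) ^ 4], and
    [expR x ^ 2 >= (1 + x) ^ 2 >= 1 + g ^ 2 u ^ 2 / 16 >= 1 + 96 u], which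
    exceeds [32 (L + 1)]; finally [3 * 256 ^ 2 <= 32 ^ 4]. *)
Lemma polylog_le (R : realType) (g u L : R) : 0 < g -> 1 <= u ->
    1536 / g ^+ 2 <= u -> 0 <= L -> L <= 2 * u ->
  3 * (256 * (L + 1) ^+ 2) ^+ 2 <= expR (2 * g * u).
Proof.
move=> g0 u1; rewrite ler_pdivrMr ?exprn_gt0// => gu L0 Lu.
have -> : 2 * g * u = 8%:R * (g * u / 4) by field.
rewrite expRM_natl.
have x0 : 0 <= g * u / 4 by rewrite divr_ge0// mulr_ge0//; lra.
have q : 32 * (L + 1) <= (expR (g * u / 4)) ^+ 2.
  apply: le_trans (_ : (1 + g * u / 4) ^+ 2 <= _); last first.
    by rewrite ler_pXn2r ?nnegrE ?expR_ge0 ?expR_ge1Dx// addr_ge0.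
  have : 1536 * u <= g ^+ 2 * u ^+ 2.
    by rewrite [u ^+ 2]expr2 mulrA ler_wpM2r//; lra.
  by nra.
have -> : expR (g * u / 4) ^+ 8 = (expR (g * u / 4) ^+ 2) ^+ 4
  by rewrite -exprM.
apply: le_trans (_ : (32 * (L + 1)) ^+ 4 <= _); last first.
  by rewrite ler_pXn2r ?nnegrE ?exprn_ge0 ?expR_ge0//; lra.
have : 0 <= (L + 1) ^+ 4 by rewrite exprn_ge0//; lra.
by rewrite !exprMn; lra.
Qed.

Lemma natr_nbr_room (R : realType) (h1 h : nat) :
  (nbr_room h1 h)%:R = 2 * (clique_room h)%:R * 2 ^+ h1.*2 :> R.
Proof.
by rewrite /nbr_room; move: (clique_room h) => w; rewrite !natrM natrX.
Qed.

Lemma pow2_le_powR (R : realType) (N c : R) (k : nat) : 0 < N ->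
  k%:R <= c * log2 N -> 2 ^+ k <= N `^ c.
Proof.
move=> N0 kc; have l2 := ln2_ge_half R.
rewrite /powR gt_eqF// -[X in X ^+ _]lnK ?posrE// -expRM_natl ler_expR.
apply: le_trans (_ : c * log2 N * ln 2 <= _); first by rewrite ler_wpM2r//; lra.
by rewrite /log2 mulrA divfK//; lra.
Qed.

Lemma clique_room_le (R : realType) (N c : R) (k : nat) : 0 < N ->
    0 <= log2 N -> c <= 1 -> k%:R <= c * log2 N ->
  (clique_room k)%:R <= 256 * (log2 N + 1) ^+ 2 * N `^ c.
Proof.
move=> N0 L0 c1 kc; rewrite /clique_room natrM natrX.
apply: ler_pM; rewrite ?exprn_ge0//; last exact: pow2_le_powR.
have kL : k.+1%:R <= log2 N + 1.
  rewrite -natr1 lerD2r; apply: le_trans kc _.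
  by rewrite -[leRHS]mul1r ler_wpM2r.
by rewrite natrM natrX ler_wpM2l// ler_pXn2r ?nnegrE//; lra.
Qed.

(** Here [s], [t] and [w] are the sizes of the first block, the second block
    and the arena, [k] is the size of the seed, and [P] collects the
    polylogarithmic factors.  Either sum is at most [3 * P ^ 2] times a power of
    [N] whose exponent falls short of the target by [2 g], and the missing
    factor [N `^ (2 * g)] pays for [3 * P ^ 2]. *)
Lemma budgets_fit (R : realType) (N g delta P a b s t w k : R) :
    1 <= N -> 1 <= P -> 3 * P ^+ 2 <= N `^ (2 * g) -> 1 <= delta ->
    [/\ 0 <= s, s <= P * N `^ a, 0 <= a & 2 * a <= 1 - 2 * g] ->
    [/\ 0 <= w, w <= P * N `^ b & 2 * b <= delta - 2 * g] ->
    [/\ 0 <= t, t <= 2 * P * N `^ (1 - 2 * g), 0 <= k & 2 * k <= P] ->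
  s + t <= N /\ s ^+ 2 + k * t + w ^+ 2 <= N `^ delta.
Proof.
move=> N1 P1 PN d1 [s0 sP a0 ag] [w0 wP bd] [t0 tP k0 kP].
have powD x y : N `^ x * N `^ y = N `^ (x + y).
  by rewrite powRD//; apply/implyP => _; rewrite gt_eqF//; lra.
have pow_le x y : x <= y -> N `^ x <= N `^ y by exact: ler_powR.
have pow0 x : 0 <= N `^ x by exact: powR_ge0.
have PP : P <= P ^+ 2 by rewrite expr2 ler_peMr//; lra.
have sq x c : 0 <= x -> x <= P * N `^ c -> 2 * c <= delta - 2 * g ->
    x ^+ 2 <= P ^+ 2 * N `^ (delta - 2 * g).
  move=> x0 xc cd; apply: le_trans (_ : (P * N `^ c) ^+ 2 <= _).
    by rewrite ler_pXn2r ?nnegrE// mulr_ge0//; lra.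
  rewrite exprMn [N `^ c ^+ 2]expr2 powD ler_wpM2l ?sqr_ge0//.
  by apply: pow_le; lra.
split.
- rewrite -[leRHS]powRr1; last by lra.
  have -> : 1 = 2 * g + (1 - 2 * g) by ring.
  rewrite -powD.
  apply: le_trans (_ : 3 * P ^+ 2 * N `^ (1 - 2 * g) <= _); last first.
    by rewrite ler_wpM2r.
  have h1 : P * N `^ a <= P ^+ 2 * N `^ (1 - 2 * g).
    by apply: ler_pM; rewrite ?powR_ge0 ?pow_le//; lra.
  have h2 : 2 * P * N `^ (1 - 2 * g) <= 2 * P ^+ 2 * N `^ (1 - 2 * g).
    by rewrite ler_wpM2r//; lra.
  by lra.
- have -> : delta = 2 * g + (delta - 2 * g) by ring.
  rewrite -powD.
  apply: le_trans (_ : 3 * P ^+ 2 * N `^ (delta - 2 * g) <= _); last first.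
    by rewrite ler_wpM2r.
  have s2 := sq s a s0 sP; have w2 := sq w b w0 wP bd.
  have {}s2 : s ^+ 2 <= P ^+ 2 * N `^ (delta - 2 * g) by apply: s2; lra.
  have kt : k * t <= P ^+ 2 * N `^ (delta - 2 * g).
    apply: le_trans (ler_wpM2l k0 tP) _.
    rewrite [_ * _](_ : _ = (2 * k) * P * N `^ (1 - 2 * g)); last by ring.
    apply: ler_pM => //.
    + by rewrite !mulr_ge0//; lra.
    + by rewrite expr2 ler_wpM2r//; lra.
    + by apply: pow_le; lra.
  by lra.
Qed.

(** With [L = log2 n], the choices are [h1 = a L] and [h = b L], rounded down,
    where [2 a = 1 - delta/2 - g] and [b = delta/2 - g].  The second block then
    needs about [n ^ (b + 2 a) = n ^ (1 - 2 g)] vertices, the third round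
    [n ^ (2 b) = n ^ (delta - 2 g)] probes, and the clique has size
    [2 (a + b) L = (1 + delta/2 - 3 g) L], up to a rounding loss of at most 4,
    which [g L >= 4] covers. *)
Lemma parameters_exist (R : realType) (delta g : R) (n : nat) :
    1 <= delta -> delta < 2 -> 0 < g -> g <= 1 / 4 -> g <= 1 - delta / 2 ->
    1 <= ln n%:R :> R -> 4 / g <= ln n%:R :> R ->
    1536 / g ^+ 2 <= ln n%:R :> R ->
  exists h1 h : nat,
    [/\ (clique_room h1 + nbr_room h1 h <= n)%N,
        (clique_room h1 ^ 2 + h1.*2 * nbr_room h1 h + clique_room h ^ 2)%N%:R
          <= n%:R `^ delta &
        (1 + delta / 2 - 4 * g) * log2 n%:R <= (h1.*2 + h.*2)%N%:R :> R].
Proof.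
move=> d1 d2 g0 g4 gd u1 ug ugg.
have N1 : 1 <= n%:R :> R.
  by rewrite leNgt; apply/negP => /ltW/ln_le0; lra.
have l2 := ln2_ge_half R; have l2' := ln2_le1 R.
have LE : log2 n%:R * ln 2 = ln n%:R :> R by rewrite /log2 divfK//; lra.
have Lu : log2 n%:R <= 2 * ln n%:R :> R by nra.
have uL : ln n%:R <= log2 n%:R :> R by nra.
have L0 : 0 <= log2 n%:R :> R by lra.
have PL := polylog_le R g (ln n%:R) (log2 n%:R) g0 u1 ugg L0 Lu.
have [a aE] : exists a, a = (1 - delta / 2 - g) / 2
  by exists ((1 - delta / 2 - g) / 2).
have [b bE] : exists b, b = delta / 2 - g by exists (delta / 2 - g).
have a0 : 0 <= a by lra.
have b0 : 0 <= b by lra.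
have [h1 /andP[h1l h1u]] : exists h1 : nat, h1%:R <= a * log2 n%:R < h1.+1%:R.
  by exists (Num.truncn (a * log2 n%:R)); apply: truncn_itv; rewrite mulr_ge0.
have [h /andP[hl hu]] : exists h : nat, h%:R <= b * log2 n%:R < h.+1%:R.
  by exists (Num.truncn (b * log2 n%:R)); apply: truncn_itv; rewrite mulr_ge0.
have N0 : 0 < n%:R :> R by lra.
have w_le : (clique_room h)%:R <= 256 * (log2 n%:R + 1) ^+ 2 * n%:R `^ b.
  by apply: clique_room_le => //; lra.
have s_le : (clique_room h1)%:R <= 256 * (log2 n%:R + 1) ^+ 2 * n%:R `^ a.
  by apply: clique_room_le => //; lra.
have t_le : (nbr_room h1 h)%:R <=
    2 * (256 * (log2 n%:R + 1) ^+ 2) * n%:R `^ (1 - 2 * g).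
  rewrite natr_nbr_room (_ : 1 - 2 * g = b + 2 * a); last by lra.
  rewrite powRD; last by apply/implyP => _; rewrite gt_eqF.
  rewrite mulrA; apply: ler_pM; rewrite ?exprn_ge0//.
    by rewrite -mulrA ler_wpM2l.
  by apply: pow2_le_powR => //; rewrite -muln2 natrM; lra.
have P4 : 4 * (log2 n%:R + 1) <= 256 * (log2 n%:R + 1) ^+ 2 :> R by nra.
have P1 : 1 <= 256 * (log2 n%:R + 1) ^+ 2 :> R by lra.
rewrite -natr1 in h1u; rewrite -natr1 in hu.
have [room probes] : (clique_room h1)%:R + (nbr_room h1 h)%:R <= n%:R :> R /\
    (clique_room h1)%:R ^+ 2 + (2 * h1%:R) * (nbr_room h1 h)%:R +
      (clique_room h)%:R ^+ 2 <= n%:R `^ delta :> R.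
  apply: (@budgets_fit R _ g delta _ a b _ _ _ _ N1 P1) => //.
  - by rewrite /powR gt_eqF.
  - by split=> //; lra.
  - by split=> //; lra.
  - have aL : a * log2 n%:R <= 1 * log2 n%:R by rewrite ler_wpM2r//; lra.
    by split=> //; lra.
exists h1, h; split.
- by rewrite -(ler_nat R) natrD.
- move: probes; move: (clique_room h1) (nbr_room h1 h) (clique_room h) => s t w.
  by rewrite !natrD natrM -muln2 natrM [h1%:R * 2]mulrC !natrX.
- have gL : 4 <= g * log2 n%:R.
    move: ug; rewrite ler_pdivrMr// mulrC => ug.
    by apply: le_trans ug _; rewrite ler_wpM2l// ltW.
  have E : a * log2 n%:R * 2 + b * log2 n%:R * 2 =
    (1 + delta / 2 - 3 * g) * log2 n%:R by rewrite aE bE; field.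
  rewrite natrD -!muln2 !natrM; lra.
Qed.

Lemma achievable_three_rounds (R : realType) (delta g : R) :
    1 <= delta -> delta < 2 -> 0 < g -> g <= 1 / 4 -> g <= 1 - delta / 2 ->
  achievable delta 3 (1 + delta / 2 - 4 * g).
Proof.
move=> d1 d2 g0 g4 gd.
pose good n (p : nat * nat) :=
  [/\ (clique_room p.1 + nbr_room p.1 p.2 <= n)%N,
      (clique_room p.1 ^ 2 + p.1.*2 * nbr_room p.1 p.2 +
        clique_room p.2 ^ 2)%N%:R <= n%:R `^ delta &
      (1 + delta / 2 - 4 * g) * log2 n%:R <= (p.1.*2 + p.2.*2)%N%:R :> R].
pose par n := xget (0%N, 0%N) [set p | good n p]%classic.
exists (fun n => three_rounds n (par n).1 (par n).2).
near=> n.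
have ln_large M : expR M <= n%:R -> M <= ln n%:R :> R.
  move=> Mn; rewrite -[leLHS]expRK ler_ln// posrE ?expR_gt0//.
  exact: lt_le_trans (expR_gt0 M) Mn.
have u1 : 1 <= ln n%:R :> R by apply: ln_large; near: n; exact: nbhs_infty_ger.
have u2 : 4 / g <= ln n%:R.
  by apply: ln_large; near: n; exact: nbhs_infty_ger.
have u3 : 1536 / g ^+ 2 <= ln n%:R.
  by apply: ln_large; near: n; exact: nbhs_infty_ger.
have [h1 [h hg]] := parameters_exist R delta g n d1 d2 g0 g4 gd u1 u2 u3.
have [room probes size] : good n (par n).
  by rewrite /par; case: xgetP => [_ -> //|/(_ (h1, h))]; case.
split=> [G|G|].
- by apply: le_trans probes; rewrite ler_nat num_probes_three_rounds.
- exact: output_is_clique.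
- apply: le_trans (three_rounds_success R n _ _ room) _.
  rewrite !Gnp_pr_half; apply: prob_le => G out.
  by apply: le_trans size _; rewrite ler_nat.
Unshelve. all: by end_near.
Qed.

Theorem lemma6 (R : realType) (delta : R) (hdelta1 : 1 <= delta)
    (hdelta2 : delta < 2) :
  ((1 + delta / 2)%:E <= alpha_star delta 3)%E.
Proof.
apply/lee_addgt0Pr => eps eps0.
pose g := Num.min (eps / 4) (Num.min (1 / 4) (1 - delta / 2)).
have g0 : 0 < g by rewrite !lt_min; apply/and3P; split; lra.
have [ge g4 gd] : [/\ g <= eps / 4, g <= 1 / 4 & g <= 1 - delta / 2].
  by rewrite /g !ge_min !lexx !orbT.
have ach := @achievable_three_rounds R delta g hdelta1 hdelta2 g0 g4 gd.
apply: le_trans (_ : (1 + delta / 2 - 4 * g)%:E + eps%:E <= _)%E.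
  by rewrite -EFinD lee_fin; lra.
rewrite leeD2r//; apply: ereal_sup_ubound.
by exists (1 + delta / 2 - 4 * g).
Qed.
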